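(* Let $\mathcal{U}$ be a properly quasi-selective (PQS) ultrafilter on $\mathbb{N}$, and let $\mathcal{P}=\langle [p_n,p_{n+1})\mid n\in\mathbb{N}\rangle$ be an interval partition of $\mathbb{N}$ without selection set in $\mathcal{U}$. Let $F_{\mathcal{U}}$ be the cut of the ultrapower $\mathbb{N}^{\mathbb{N}}/\mathcal{U}$ whose left part is generated by $\mathcal{F}_{\mathcal{U}}$, and let $E^{\mathcal{U}},S^{\mathcal{U}},A_p^{\mathcal{U}},B_p^{\mathcal{U}},C_p^{\mathcal{U}}$ be the cuts of $\mathbb{N}^{\mathbb{N}}/\mathcal{U}$ whose right parts are generated by $\mathcal{E}^{\mathcal{U}},\mathcal{S}^{\mathcal{U}},\mathcal{A}_p^{\mathcal{U}},\mathcal{B}_p^{\mathcal{U}},\mathcal{C}_p^{\mathcal{U}}$, respectively. Then all these cuts, except possibly $A_p^{\mathcal{U}}$, are (strictly) greater than $\mathbb{N}$, and $$A_p^{\mathcal{U}}\le E^{\mathcal{U}},\qquad S^{\mathcal{U}}\le E^{\mathcal{U}},\qquad F_{\mathcal{U}}\le B_p^{\mathcal{U}},\qquad \max\{A_p^{\mathcal{U}},B_p^{\mathcal{U}}\}=C_p^{\mathcal{U}}.$$ Moreover, $\mathcal{U}$ is strongly quasi-selective (SQS) if and only if $E^{\mathcal{U}}<F_{\mathcal{U}}$, and in this case $$A_p^{\mathcal{U}}=S^{\mathcal{U}}=E^{\mathcal{U}}<F_{\mathcal{U}}\le B_p^{\mathcal{U}}=C_p^{\mathcal{U}}.$$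
   Context: All ultrafilters are nonprincipal ultrafilters on $\mathbb{N}$, and all functions are $\mathbb{N}\to\mathbb{N}$. A function is (strictly) increasing, nondecreasing, or one-to-one modulo $\mathcal{U}$ if its restriction to some $U\in\mathcal{U}$ has that property; it is unbounded modulo $\mathcal{U}$ if it is not bounded on any set of $\mathcal{U}$. For $f$ unbounded modulo $\mathcal{U}$, $\mathcal{U}$ is $f$-quasi-selective ($f$-QS) if every $g$ for which there is $U\in\mathcal{U}$ with $g(x)\le f(x)$ for all $x\in U$ is nondecreasing modulo $\mathcal{U}$. $\mathcal{U}$ is properly quasi-selective (PQS) if it is $f$-QS for some, but not for all, functions $f$ unbounded modulo $\mathcal{U}$; it is strongly quasi-selective (SQS) if it is $f$-QS for some one-to-one function $f$. An interval partition is a partition of $\mathbb{N}$ into finite intervals $[p_n,p_{n+1})$, with $0=p_0<p_1<p_2<\cdots$. It has no selection set in $\mathcal{U}$ if there is no $U\in\mathcal{U}$ with $|U\cap[p_n,p_{n+1})|\le 1$ for all $n$. For $U\in\mathcal{U}$ and $p_n\le x<p_{n+1}$ put $$a_p^U(x)=|U\cap[p_n,x)|,\quad b_p^U(x)=|U\cap[x,p_{n+1})|,\quad c_p^U(x)=|U\cap[p_n,p_{n+1})|,$$ and let $\mathcal{A}_p^{\mathcal{U}}=\{a_p^U\mid U\in\mathcal{U}\}$, $\mathcal{B}_p^{\mathcal{U}}=\{b_p^U\mid U\in\mathcal{U}\}$, $\mathcal{C}_p^{\mathcal{U}}=\{c_p^U\mid U\in\mathcal{U}\}$. Also let $\mathcal{E}^{\mathcal{U}}=\{f\mid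 f$ increasing modulo $\mathcal{U}\}$, $\mathcal{S}^{\mathcal{U}}=\{f\mid f$ one-to-one modulo $\mathcal{U}\}$, $\mathcal{F}_{\mathcal{U}}=\{f\mid \mathcal{U}$ is $f$-QS$\}$. A cut of the linearly ordered ultrapower $\mathbb{N}^{\mathbb{N}}/\mathcal{U}$ is a partition of it into a downward closed left part and an upward closed right part. The cut whose right part (resp. left part) is generated by a family of functions is the one whose right (resp. left) part is the upward (resp. downward) closure of the set of $\mathcal{U}$-equivalence classes of the members of the family. Cuts are ordered by inclusion of their left parts. The cut $\mathbb{N}$ is the one whose left part consists of the classes of the constant functions. *)

(* Defs.v *)
From HB Require Import structures.
From mathcomp Require Import all_boot all_order.
From mathcomp Require Import boolp classical_sets functions filter.

Set Implicit Arguments.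
Unset Strict Implicit.
Unset Printing Implicit Defensive.

Import Order.TTheory.
Local Open Scope classical_set_scope.
Local Open Scope quotient_scope.

Record np_ultrafilter := NPUltrafilter {
  np_sets :> set nat -> Prop;
  np_ultra : UltraFilter np_sets;
  np_nonprincipal : ~ exists n, np_sets = principal_filter n }.

#[global] Existing Instance np_ultra.

Section ModuloU.
Variable U : np_ultrafilter.
Implicit Types f g : nat -> nat.

Definition increasing_mod f :=
  exists2 V : set nat, U V & {in V &, {homo f : x y / (x < y)%N}}.

Definition nondecreasing_mod f :=
  exists2 V : set nat, U V & {in V &, {homo f : x y / (x <= y)%N}}.

Definition injective_mod f := exists2 V : set nat, U V & {in V &, injective f}.

Definition unbounded_mod f :=
  ~ exists2 V : set nat, U V & exists m, forall x, V x -> (f x <= m)%N.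

Definition quasi_selective f :=
  unbounded_mod f /\
  forall g, (exists2 V : set nat, U V & forall x, V x -> (g x <= f x)%N) ->
    nondecreasing_mod g.

Definition properly_quasi_selective :=
  (exists2 f, unbounded_mod f & quasi_selective f) /\
  ~ (forall f, unbounded_mod f -> quasi_selective f).

Definition strongly_quasi_selective :=
  exists2 f, injective f & quasi_selective f.

Definition increasing_family : set (nat -> nat) := [set f | increasing_mod f].
Definition injective_family : set (nat -> nat) := [set f | injective_mod f].
Definition qs_family : set (nat -> nat) := [set f | quasi_selective f].

End ModuloU.

Definition interval_partition (p : nat -> nat) :=
  p 0 = 0 /\ {homo p : m n / (m < n)%N}.

Definition card_in (V : set nat) (m n : nat) : nat :=
  count (mem V) (index_iota m n).

Definition has_selection_set (U : np_ultrafilter) (p : nat -> nat) :=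
  exists2 V : set nat, U V & forall n, (card_in V (p n) (p n.+1) <= 1)%N.

(* The index n with p n <= x < p n.+1, see part_indexP; the range of the maximum
   is large enough since n <= p n. *)
Definition part_index (p : nat -> nat) (x : nat) : nat :=
  \max_(n < x.+1 | (p n <= x)%N) n.

Definition count_before (p : nat -> nat) (V : set nat) (x : nat) : nat :=
  card_in V (p (part_index p x)) x.
Definition count_after (p : nat -> nat) (V : set nat) (x : nat) : nat :=
  card_in V x (p (part_index p x).+1).
Definition count_part (p : nat -> nat) (V : set nat) (x : nat) : nat :=
  card_in V (p (part_index p x)) (p (part_index p x).+1).

Definition before_family (U : np_ultrafilter) p := [set count_before p V | V in np_sets U].
Definition after_family (U : np_ultrafilter) p := [set count_after p V | V in np_sets U].
Definition part_family (U : np_ultrafilter) p := [set count_part p V | V in np_sets U].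

Lemma part_indexP p n x : interval_partition p ->
  (p n <= x < p n.+1)%N -> part_index p x = n.
Proof.
move=> [p0 pS] /andP[px xp].
have pge k : (k <= p k)%N.
  by elim: k => // k IH; exact: leq_ltn_trans IH (pS _ _ (ltnSn k)).
have nx : (n < x.+1)%N by rewrite ltnS (leq_trans (pge n)).
apply/eqP; rewrite eqn_leq; apply/andP; split.
  apply/bigmax_leqP => i pix; rewrite leqNgt; apply/negP => ni.
  have := leq_trans xp (ltnW_homo pS ni).
  by rewrite ltnNge pix.
exact: (leq_bigmax_cond (Ordinal nx)).
Qed.

Section Ultrapower.
Variable U : np_ultrafilter.
Implicit Types f g h : nat -> nat.

Definition ultra_eq f g : bool := `[< U [set x | f x = g x] >].

Lemma ultra_eq_refl : reflexive ultra_eq.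
Proof. by move=> f; apply/asboolP; apply: filterS filterT. Qed.

Lemma ultra_eq_sym : symmetric ultra_eq.
Proof.
by move=> f g; apply/asboolP/asboolP; apply: filterS => x /= ->.
Qed.

Lemma ultra_eq_trans : transitive ultra_eq.
Proof.
move=> g f h /asboolP fg /asboolP gh; apply/asboolP.
by apply: filterS2 fg gh => x /= -> ->.
Qed.

Canonical ultra_equiv :=
  EquivRel ultra_eq ultra_eq_refl ultra_eq_sym ultra_eq_trans.

Definition ultrapower : Type := {eq_quot ultra_equiv}.
HB.instance Definition _ := Choice.on ultrapower.
HB.instance Definition _ := EqQuotient.on ultrapower.

Definition uclass f : ultrapower := \pi_ultrapower f.

Lemma uclassP f g : uclass f = uclass g <-> U [set x | f x = g x].
Proof.
by split=> [/eqmodP/asboolP//|fg]; apply/eqmodP/asboolP.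
Qed.

Definition ultra_le (a b : ultrapower) : bool :=
  `[< U [set x | (repr a x <= repr b x)%N] >].

Lemma ultra_leP f g :
  ultra_le (uclass f) (uclass g) <-> U [set x | (f x <= g x)%N].
Proof.
have rep h : U [set x | repr (uclass h) x = h x] by apply/uclassP; exact: reprK.
have Urf := rep f; have Urg := rep g.
split=> [/asboolP le|le]; last apply/asboolP;
  by apply: filterS3 le Urf Urg => x /= le ef eg; move: le; rewrite ef eg.
Qed.

Lemma ultra_le_refl : reflexive ultra_le.
Proof. by move=> a; apply/asboolP; apply: filterS filterT => x _ /=. Qed.

Lemma ultra_le_anti : antisymmetric ultra_le.
Proof.
move=> a b /andP[/asboolP ab /asboolP ba].
rewrite -[a]reprK -[b]reprK; apply/uclassP.
by apply: filterS2 ab ba => x /= ab ba; apply/eqP; rewrite eqn_leq ab.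
Qed.

Lemma ultra_le_trans : transitive ultra_le.
Proof.
move=> b a c /asboolP ab /asboolP bc; apply/asboolP.
by apply: filterS2 ab bc => x; exact: leq_trans.
Qed.

Lemma ultra_le_total : total ultra_le.
Proof.
move=> a b; apply/orP.
have [ab|ab] :=
    in_ultra_setVsetC [set x | (repr a x <= repr b x)%N] (np_ultra U).
  by left; apply/asboolP.
right; apply/asboolP; apply: filterS ab => x /= /negP.
by rewrite -ltnNge; exact: ltnW.
Qed.

Fact ultra_display : Order.disp_t. Proof. exact: Order.Disp tt tt. Qed.

HB.instance Definition _ := Order.Le_isPOrder.Build ultra_display ultrapower
  ultra_le_refl ultra_le_anti ultra_le_trans.
HB.instance Definition _ := Order.POrder_isTotal.Build ultra_display ultrapower
  ultra_le_total.

End Ultrapower.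

Section Cut.
Context {d : Order.disp_t} {T : orderType d}.
Local Open Scope order_scope.
Local Open Scope classical_set_scope.

Record cut := Cut {
  cut_left : set T;
  cut_right : set T;
  cut_left_closed : forall x y, x <= y -> cut_left y -> cut_left x;
  cut_right_closed : forall x y, x <= y -> cut_right x -> cut_right y;
  cut_cover : cut_left `|` cut_right = setT;
  cut_disjoint : cut_left `&` cut_right = set0 }.

HB.instance Definition _ := gen_eqMixin cut.
HB.instance Definition _ := gen_choiceMixin cut.

Lemma cut_rightE (c : cut) : cut_right c = ~` cut_left c.
Proof.
apply/seteqP; split=> x.
  move=> rx lx; have : (cut_left c `&` cut_right c) x by split.
  by rewrite cut_disjoint.
by move=> lx; have : setT x := I; rewrite -(cut_cover c) => -[].
Qed.

Lemma cut_eqP (c c' : cut) : cut_left c = cut_left c' -> c = c'.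
Proof.
move=> e; have := cut_rightE c; rewrite e -cut_rightE; move: e.
case: c c' => l r ? ? ? ? [l' r' ? ? ? ?] /= el er; subst l' r'.
by congr Cut; exact: Prop_irrelevance.
Qed.

Definition cut_le (c c' : cut) : bool := `[< cut_left c `<=` cut_left c' >].

Lemma cut_le_refl : reflexive cut_le.
Proof. by move=> c; apply/asboolP. Qed.

Lemma cut_le_anti : antisymmetric cut_le.
Proof.
by move=> c c' /andP[/asboolP ? /asboolP ?]; apply/cut_eqP/seteqP.
Qed.

Lemma cut_le_trans : transitive cut_le.
Proof.
by move=> c' c c'' /asboolP h /asboolP h'; apply/asboolP; exact: subset_trans h'.
Qed.

Lemma cut_le_total : total cut_le.
Proof.
move=> c c'; apply/orP.
have [h|/existsNP[x /not_implyP[cx c'x]]] := pselect (cut_left c `<=` cut_left c').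
  by left; apply/asboolP.
right; apply/asboolP => y c'y; have [yx|xy] := leP y x.
  exact: cut_left_closed cx.
by case: c'x; exact: cut_left_closed (ltW xy) c'y.
Qed.

Fact cut_display : Order.disp_t. Proof. exact: Order.Disp tt tt. Qed.

HB.instance Definition _ := Order.Le_isPOrder.Build cut_display cut
  cut_le_refl cut_le_anti cut_le_trans.
HB.instance Definition _ := Order.POrder_isTotal.Build cut_display cut
  cut_le_total.

Definition down_closure (G : set T) : set T := [set x | exists2 y, G y & x <= y].
Definition up_closure (G : set T) : set T := [set x | exists2 y, G y & y <= x].

Lemma down_closure_closed G x y :
  x <= y -> down_closure G y -> down_closure G x.
Proof. by move=> xy [z Gz yz]; exists z => //; exact: le_trans yz. Qed.

Lemma up_closure_closed G x y : x <= y -> up_closure G x -> up_closure G y.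
Proof. by move=> xy [z Gz zx]; exists z => //; exact: le_trans xy. Qed.

Lemma setC_down_closed (A : set T) :
  (forall x y, x <= y -> A y -> A x) -> forall x y, x <= y -> (~` A) x -> (~` A) y.
Proof. by move=> Ad x y xy nAx Ay; apply/nAx/(Ad x y). Qed.

Lemma setC_up_closed (A : set T) :
  (forall x y, x <= y -> A x -> A y) -> forall x y, x <= y -> (~` A) y -> (~` A) x.
Proof. by move=> Au x y xy nAy Ax; apply/nAy/(Au x y). Qed.

Definition cut_of_left (A : set T) (Ad : forall x y, x <= y -> A y -> A x) : cut :=
  @Cut A (~` A) Ad (setC_down_closed Ad) (setUv A) (setICr A).

Definition cut_of_right (A : set T) (Au : forall x y, x <= y -> A x -> A y) : cut :=
  @Cut (~` A) A (setC_up_closed Au) Au (setvU A) (setICl A).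

Definition left_generated (G : set T) : cut :=
  cut_of_left (@down_closure_closed G).

Definition right_generated (G : set T) : cut :=
  cut_of_right (@up_closure_closed G).

End Cut.
Arguments cut {d} T.

Section UltrapowerCuts.
Variable U : np_ultrafilter.

Definition standard : set (ultrapower U) := range (fun n => uclass U (fun=> n)).

Lemma standard_closed (a b : ultrapower U) :
  (a <= b)%O -> standard b -> standard a.
Proof.
move=> ab [n _ bE]; move: ab; rewrite -{}bE -[a]reprK.
set f := repr a => /ultra_leP; elim: n => [|n IH] le_fn.
  exists 0 => //; apply/uclassP; apply: filterS le_fn => x /=.
  by rewrite leqn0 => /eqP.
have [fle|fgt] := in_ultra_setVsetC [set x | (f x <= n)%N] (np_ultra U).
  exact: IH.
exists n.+1 => //; apply/uclassP; apply: filterS2 le_fn fgt => x /= le /negP.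
by rewrite -ltnNge => gt; apply/eqP; rewrite eqn_leq le gt.
Qed.

Definition cutN : cut (ultrapower U) := cut_of_left standard_closed.

Definition cutF : cut (ultrapower U) :=
  left_generated (uclass U @` qs_family U).
Definition cutE : cut (ultrapower U) :=
  right_generated (uclass U @` increasing_family U).
Definition cutS : cut (ultrapower U) :=
  right_generated (uclass U @` injective_family U).
Definition cutA p : cut (ultrapower U) :=
  right_generated (uclass U @` before_family U p).
Definition cutB p : cut (ultrapower U) :=
  right_generated (uclass U @` after_family U p).
Definition cutC p : cut (ultrapower U) :=
  right_generated (uclass U @` part_family U p).

End UltrapowerCuts.

(* Main.v *)
Require Import Defs.
From mathcomp Require Import all_boot all_order.
From mathcomp Require Import boolp classical_sets filter.
From mathcomp Require Import zify.

(** The order of the cuts is total and is decided by their generators.  So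
    every assertion of the theorem says that some function of one generating
    family does, or that none does, lie below a given function modulo U.

    Why F <= B.  For V in U, the function b^V decreases strictly along V inside
    each block.  If it were below some f for which U is f-quasi-selective, it
    would be nondecreasing on a set of U.  That set would meet V in at most one
    point of each block, so it would yield a selection set
    ([not_count_after_le]).

    Why N < S.  Let U be f-quasi-selective.  Then f is nondecreasing on a set of
    U; let h be, on each block, one less than the minimum of f on the part of
    that set in the block.  This function h is still unbounded.  If a function
    one-to-one on V in U were below h, each block would contain at most
    h + 1 <= f points of V, so b^V would be below f, which was just excluded
    ([exists_below_injective]).  As S <= E, this also gives N < E.

    Why max{A, B} = C.  Clearly c^V = a^V + b^V, so C is above A and B.
    Conversely, let x be the one of a, b that gives the larger cut.  Then every
    x^V dominates the other count for some set of U, hence twice x^V dominates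
    some c^W.  The factor two is absorbed by first replacing V with one point in
    four of V, which can be done inside U ([thinning]).

    Why strong quasi-selectivity is E < F.  An injective f in F is nondecreasing
    modulo U, hence increasing modulo U, so f separates E from F.  Conversely,
    if F has a member above a function increasing modulo U, then counting the
    points of a thinned set of U gives an injective function below it.

    Why A = S = E in the strong case.  Let f be increasing modulo U and in F.
    A function g which is not above f is below it, hence nondecreasing modulo U.
    If g is one-to-one modulo U it is then increasing modulo U.  If g = a^V it
    becomes increasing once the first point of each block is dropped, which is
    harmless because these points form a selection set.  Either way g lies above
    a function increasing modulo U. *)

Set Implicit Arguments.
Unset Strict Implicit.
Unset Printing Implicit Defensive.

Import Order.TTheory.
Local Open Scope classical_set_scope.

(** * Counting the points of a set in an interval *)

Lemma card_in_recr V m n : m <= n ->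
  card_in V m n.+1 = card_in V m n + (n \in V).
Proof.
move=> mn; rewrite /card_in /index_iota subSn // -addn1 iotaD count_cat /=.
by rewrite subnKC // addn0.
Qed.

Lemma card_in_nn V m : card_in V m m = 0.
Proof. by rewrite /card_in /index_iota subnn. Qed.

Lemma card_in_cat V m n k : m <= n <= k ->
  card_in V m k = card_in V m n + card_in V n k.
Proof.
move=> /andP[mn]; elim: k => [|k IH].
  by rewrite leqn0 => /eqP ->; rewrite card_in_nn addn0.
rewrite leq_eqVlt => /orP[/eqP <-|]; first by rewrite card_in_nn addn0.
by rewrite ltnS => nk; rewrite !card_in_recr ?IH ?addnA //; lia.
Qed.

Lemma card_in_sub (V W : set nat) m n : W `<=` V ->
  card_in W m n <= card_in V m n.
Proof.
by move=> WV; apply: sub_count => x; rewrite !inE; exact: WV.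
Qed.

Lemma card_in_ltn (V : set nat) m x y : V x -> m <= x < y ->
  card_in V m x < card_in V m y.
Proof.
move=> Vx /andP[mx xy].
rewrite (@card_in_cat V m x.+1 y) ?card_in_recr //; last lia.
by rewrite mem_set //=; lia.
Qed.

Lemma card_in_ltnr (V : set nat) x y n : V x -> x < y <= n ->
  card_in V y n < card_in V x n.
Proof.
move=> Vx /andP[xy yn].
rewrite (@card_in_cat V x y n); last lia.
suff : card_in V x x < card_in V x y by lia.
by apply: card_in_ltn; rewrite ?leqnn.
Qed.

(** The pigeonhole principle, in the form in which a one-to-one function bounds
    the number of points from above. *)
Lemma card_in_inj (V : set nat) m n (e : nat -> nat) k :
  {in V &, injective e} -> (forall y, V y -> m <= y < n -> e y < k) ->
  card_in V m n <= k.
Proof.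
move=> einj elt; rewrite /card_in -size_filter -(size_map e) -[k in _ <= k](size_iota 0).
apply: uniq_leq_size.
  rewrite map_inj_in_uniq ?filter_uniq ?iota_uniq // => x y.
  by rewrite !mem_filter => /andP[Vx _] /andP[Vy _]; exact: einj.
move=> _ /mapP[y + ->]; rewrite mem_filter mem_index_iota mem_iota add0n.
by move=> /andP[/set_mem Vy yn]; exact: elt.
Qed.

Lemma card_in_le1 (V : set nat) m n :
  (forall x y, V x -> V y -> m <= x -> x < y -> y < n -> False) ->
  card_in V m n <= 1.
Proof.
move=> noxy; elim: n {-2}n (leqnn n) noxy => [|k IH] n.
  by rewrite leqn0 => /eqP -> _; rewrite /card_in /index_iota sub0n.
rewrite leq_eqVlt => /orP[/eqP -> noxy|]; last by rewrite ltnS; exact: IH.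
have [mk|km] := leqP m k; last first.
  by rewrite /card_in /index_iota (eqP (_ : k.+1 - m == 0)).
rewrite card_in_recr //; case: (boolP (k \in V)) => [/set_mem Vk|_].
  (* Once the last point k belongs to V, no earlier point does. *)
  rewrite -[X in X + _](_ : 0 = _) //; apply/esym/eqP; rewrite -leqn0.
  rewrite /card_in leqNgt -has_count; apply/hasP => -[x].
  rewrite mem_index_iota => /andP[mx xk] /set_mem Vx.
  exact: noxy Vx Vk mx xk (ltnSn k).
rewrite addn0; apply: IH => // x y Vx Vy mx xy yk.
by apply: noxy Vx Vy mx xy _; exact: ltnW.
Qed.

(** * Blocks of an interval partition *)

Section Blocks.
Variables (p : nat -> nat) (hp : interval_partition p).

Lemma leq_endpoint k : k <= p k.
Proof.
by elim: k => // k IH; exact: leq_ltn_trans IH (hp.2 _ _ (ltnSn k)).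
Qed.

Lemma endpoint_homo : {homo p : m n / m <= n}.
Proof. exact: ltnW_homo hp.2. Qed.

Lemma part_index_itv x : p (part_index p x) <= x < p (part_index p x).+1.
Proof.
suff [n xn] : exists n, p n <= x < p n.+1 by rewrite (part_indexP hp xn).
elim: x => [|x [n /andP[px xp]]].
  by exists 0; have := hp.2 0 1 isT; rewrite hp.1.
have [lt|ge] := ltnP x.+1 (p n.+1); first by exists n; rewrite lt; lia.
by exists n.+1; rewrite ge /=; have := hp.2 n.+1 n.+2 (ltnSn _); lia.
Qed.

Lemma part_index_homo : {homo part_index p : x y / x <= y}.
Proof.
move=> x y xy; rewrite leqNgt; apply/negP => lt.
have /andP[px _] := part_index_itv x; have /andP[_ yp] := part_index_itv y.
by have := endpoint_homo lt; lia.
Qed.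

Lemma count_partE V x : count_part p V x = count_before p V x + count_after p V x.
Proof. by apply: card_in_cat; have := part_index_itv x; lia. Qed.

End Blocks.

(** * Functions modulo an ultrafilter *)

Section Modulo.
Variable U : np_ultrafilter.
Implicit Types (V W : set nat) (f g h : nat -> nat).

Lemma ultra_not V : ~ U V -> U (~` V).
Proof. by have [] := in_ultra_setVsetC V (np_ultra U). Qed.

Lemma ultraI V W : U V -> U W -> U (V `&` W).
Proof. exact: filterI. Qed.

Lemma ultra_le_id f : U [set x | f x <= f x].
Proof. by apply: filterS filterT => x /=. Qed.

Lemma ultra_leVge f g :
  U [set x | f x <= g x] \/ U [set x | g x <= f x].
Proof.
have [|ngt] := pselect (U [set x | f x <= g x]); first by left.
by right; apply: filterS (ultra_not ngt) => x /= /negP; rewrite -ltnNge => /ltnW.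
Qed.

(** Otherwise U would contain an initial segment, hence a singleton, and it
    would be principal. *)
Lemma ultra_ge n : U [set x | n <= x].
Proof.
elim: n => [|n IH]; first exact: filterS filterT.
have [Un|nUn] := pselect (U [set n]); last first.
  apply: filterS2 IH (ultra_not nUn) => x /= nx xn.
  by rewrite ltn_neqAle nx andbT; apply/eqP => e; exact: xn.
exfalso; apply: (@np_nonprincipal U); exists n; apply/seteqP; split=> V.
  move=> UV; apply/principal_filterP.
  by have [x [-> Vx]] := filter_ex (ultraI Un UV).
by move=> /principal_filterP Vn; apply: filterS Un => x ->.
Qed.

Lemma ultra_next V n : U V -> exists2 x, V x & n <= x.
Proof. by move=> UV; have [x []] := filter_ex (ultraI UV (ultra_ge n)); exists x. Qed.

Lemma ultra_card V k : U V -> U [set x | k <= card_in V 0 x].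
Proof.
move=> UV; elim: k => [|k IH]; first exact: filterS filterT.
have [n kn] := filter_ex IH.
have [y Vy ny] := ultra_next n UV.
apply: filterS (ultra_ge y.+1) => x /= yx.
apply: leq_ltn_trans kn (leq_ltn_trans _ (card_in_ltn Vy _)); last by rewrite yx.
by rewrite [X in _ <= X](@card_in_cat V 0 n) ?leq_addr.
Qed.

Lemma unbounded_modP f : unbounded_mod U f <-> forall m, U [set x | m < f x].
Proof.
split=> [unb m|big [V UV [m fm]]]; last first.
  by have [x [/fm + /=]] := filter_ex (ultraI UV (big m)); lia.
have [//|nU] := pselect (U [set x | m < f x]).
exfalso; apply: unb; exists (~` [set x | m < f x]); first exact: ultra_not.
by exists m => x /= /negP; rewrite -leqNgt.
Qed.

Lemma unbounded_mod_le f g :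
  U [set x | f x <= g x] -> unbounded_mod U f -> unbounded_mod U g.
Proof.
move=> fg /unbounded_modP unb; apply/unbounded_modP => m.
by apply: filterS2 fg (unb m) => x /=; lia.
Qed.

Lemma injective_mod_unbounded f : injective_mod U f -> unbounded_mod U f.
Proof.
move=> [V UV finj] [V' UV' [m fm]].
have UW := ultraI UV UV'.
have [x /= mx] := filter_ex (ultra_card m.+2 UW).
suff : card_in (V `&` V') 0 x <= m.+1 by lia.
apply: (@card_in_inj _ _ _ f) => [y z /set_mem[Vy _] /set_mem[Vz _]|y [_ /fm]//].
by apply: finj; exact: mem_set.
Qed.

Lemma increasing_mod_injective f : increasing_mod U f -> injective_mod U f.
Proof.
move=> [V UV finc]; exists V => // x y Vx Vy fxy.
by case: (ltngtP x y) => // [/(finc _ _ Vx Vy)|/(finc _ _ Vy Vx)]; rewrite fxy ltnn.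
Qed.

Lemma nondecreasing_injective_mod f :
  nondecreasing_mod U f -> injective_mod U f -> increasing_mod U f.
Proof.
move=> [V UV fnd] [W UW finj]; exists (V `&` W); first exact: ultraI.
move=> x y /set_mem[Vx Wx] /set_mem[Vy Wy] xy.
rewrite ltn_neqAle fnd ?mem_set // ?(ltnW xy) // andbT.
by apply/eqP => /finj; rewrite !mem_set // => /(_ isT isT); lia.
Qed.

Lemma quasi_selective_le f g : quasi_selective U f -> unbounded_mod U g ->
  U [set x | g x <= f x] -> quasi_selective U g.
Proof.
move=> [_ fqs] gunb gf; split=> // h [V UV hg]; apply: fqs.
by exists (V `&` [set x | g x <= f x]); [exact: ultraI|move=> x [/hg] /=; lia].
Qed.

Lemma quasi_selective_nondecreasing f g : quasi_selective U f ->
  U [set x | g x <= f x] -> nondecreasing_mod U g.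
Proof. by move=> [_ fqs] gf; apply: fqs; exists [set x | g x <= f x]. Qed.

(** The points of V of even rank and those of odd rank split V in two, and U
    contains one of the halves. *)
Lemma halving V : U V -> exists W, [/\ U W, W `<=` V &
  forall s t, s <= t -> 2 * card_in W s t <= card_in V s t + 1].
Proof.
move=> UV; pose N := card_in V 0.
pose H (q : bool) := V `&` [set x | odd (N x + q)].
have cardH q s t : s <= t -> card_in (H q) s t + (N s + q)./2 = (N t + q)./2.
  elim: t => [|t IH].
    by rewrite leqn0 => /eqP ->; rewrite card_in_nn.
  rewrite leq_eqVlt => /orP[/eqP ->|]; first by rewrite card_in_nn.
  rewrite ltnS => st; rewrite card_in_recr // -addnA [(t \in _) + _]addnC addnA.
  rewrite IH // /N card_in_recr // -/N.
  suff -> : (t \in H q) = (t \in V) && odd (N t + q) by case: (t \in V); lia.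
  by rewrite in_setI; congr andb; apply/idP/idP => [/set_mem//|?]; rewrite inE.
have [q UH] : exists q, U (H q).
  have [U0|nU0] := pselect (U (H false)); first by exists false.
  exists true; apply: filterS2 UV (ultra_not nU0) => x Vx nHx; split=> //=.
  by apply/negPn/negP => od; apply: nHx; split=> //=; lia.
exists (H q); split=> // [x []//|s t st].
have := cardH q s t st; have : N t = N s + card_in V s t by apply: card_in_cat.
by lia.
Qed.

Lemma thinning V : U V -> exists W, [/\ U W, W `<=` V &
  forall s t, s <= t -> 4 * card_in W s t <= card_in V s t + 3].
Proof.
move=> /halving[V1 [UV1 V1V c1]]; have [W [UW WV1 c2]] := halving UV1.
exists W; split=> // [x /WV1/V1V//|s t st].
by have := c1 s t st; have := c2 s t st; lia.
Qed.

(** The witness sends a thinned part of V to even numbers and its complement to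
    odd ones, which makes it injective everywhere. *)
Lemma injective_below_increasing g : increasing_mod U g ->
  exists2 f, injective f & U [set x | f x <= g x].
Proof.
move=> ginc; have [V UV ginj] := increasing_mod_injective ginc.
have {ginc} [V' UV' ginc] := ginc.
have {V UV ginj V' UV' ginc} [V UV cardg] :
    exists2 V, U V & forall x, V x -> card_in V 0 x <= g x.
  exists (V `&` V') => [|x [Vx V'x]]; first exact: ultraI.
  apply: (@card_in_inj _ _ _ g) => [y z /set_mem[Vy _] /set_mem[Vz _]|y].
    by apply: ginj; exact: mem_set.
  by move=> [Vy V'y] yx; apply: ginc; rewrite ?mem_set.
have [W [UW WV cW]] := thinning UV.
have Wlt x y : x \in W -> x < y -> card_in W 0 x < card_in W 0 y.
  by move=> /set_mem Wx xy; exact: card_in_ltn.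
exists (fun x => if x \in W then (card_in W 0 x).*2 else x.*2.+1).
  move=> x y; case: ifPn => Wx; case: ifPn => Wy; [|lia..].
  by case: (ltngtP x y) => // [/(Wlt _ _ Wx)|/(Wlt _ _ Wy)]; lia.
apply: filterS2 UW (ultra_card 3 UV) => x Wx /= c3; rewrite mem_set //.
by have := cW 0 x (leq0n _); have := cardg x (WV _ Wx); lia.
Qed.

Lemma strongly_quasi_selectiveP : strongly_quasi_selective U <->
  exists f g, [/\ quasi_selective U f, increasing_mod U g &
    U [set x | g x <= f x]].
Proof.
split=> [[f finj fqs]|[f [g [fqs ginc gf]]]].
  exists f, f; split=> //; last exact: ultra_le_id.
  apply: nondecreasing_injective_mod; last first.
    by exists setT; [exact: filterT|move=> x y _ _ /finj].
  by apply: quasi_selective_nondecreasing fqs _; exact: ultra_le_id.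
have [e einj eg] := injective_below_increasing ginc.
exists e => //; apply: quasi_selective_le fqs _ _.
  apply: injective_mod_unbounded; exists setT; first exact: filterT.
  by move=> x y _ _ /einj.
by apply: filterS2 eg gf => x /=; exact: leq_trans.
Qed.

(** In the strong case a function increasing modulo U lies below some f for which
    U is f-quasi-selective.  A g not above the former is below f, hence
    nondecreasing modulo U; this reduces the inclusion of a family in the right
    part of E to its nondecreasing members. *)
Lemma strongly_quasi_selective_above g : strongly_quasi_selective U ->
  (nondecreasing_mod U g -> exists2 e, increasing_mod U e & U [set x | e x <= g x]) ->
  exists2 e, increasing_mod U e & U [set x | e x <= g x].
Proof.
move=> /strongly_quasi_selectiveP[f [h [fqs hinc hf]]] gnd.
have [hg|gh] := ultra_leVge h g; first by exists h.
apply/gnd/(quasi_selective_nondecreasing fqs).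
by apply: filterS2 gh hf => x /=; exact: leq_trans.
Qed.

(** * Counting functions of a partition without selection set *)

Section Counts.
Variables (p : nat -> nat) (hp : interval_partition p).
Hypothesis hsel : ~ has_selection_set U p.

Lemma not_selection V : U V ->
  (forall x y, V x -> V y -> x < y -> part_index p x = part_index p y -> False) ->
  False.
Proof.
move=> UV noxy; apply: hsel; exists V => // n; apply: card_in_le1.
move=> x y Vx Vy nx xy yn; apply: (noxy x y) => //.
by rewrite !(@part_indexP _ n) //; lia.
Qed.

Lemma not_count_after_le f V : quasi_selective U f -> U V ->
  ~ U [set x | count_after p V x <= f x].
Proof.
move=> fqs UV /(quasi_selective_nondecreasing fqs)[W UW bnd].
apply: (not_selection (ultraI UV UW)) => x y [Vx Wx] [_ Wy] xy exy.
have /bnd : x <= y by exact: ltnW.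
rewrite !mem_set // => /(_ isT isT); rewrite /count_after exy leqNgt => /negP; apply.
by apply: card_in_ltnr => //; have := part_index_itv hp y; lia.
Qed.

Lemma exists_below_injective f : quasi_selective U f ->
  exists2 h, unbounded_mod U h &
    forall g, injective_mod U g -> ~ U [set x | g x <= h x].
Proof.
move=> fqs.
have [V UV fnd] : nondecreasing_mod U f.
  by apply: quasi_selective_nondecreasing fqs _; exact: ultra_le_id.
(* As f is nondecreasing on V, its minimum over the points of V in a block is
   attained at the first of them. *)
have has_first n : exists m, [/\ V m, n <= m & forall y, V y -> n <= y -> m <= y].
  have ex : exists y, (y \in V) && (n <= y).
    by have [y Vy ny] := ultra_next n UV; exists y; rewrite mem_set.
  case: (ex_minnP ex) => m /andP[/set_mem Vm nm] mmin.
  by exists m; split=> // y Vy ny; apply: mmin; rewrite mem_set.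
have [first firstP] := choice has_first.
pose low x := f (first (p (part_index p x))).
have low_big m : U [set x | m < low x].
  have /unbounded_modP/(_ m) fm := fqs.1.
  have [y [Vy /= my]] := filter_ex (ultraI UV fm).
  apply: filterS (ultra_ge (p y)) => x /= yx.
  have [Vz zge _] := firstP (p (part_index p x)).
  apply: leq_trans my (fnd _ _ _ _ _); rewrite ?mem_set //.
  apply: leq_trans zge; apply: leq_trans (leq_endpoint hp _).
  rewrite leqNgt; apply/negP => /(endpoint_homo hp).
  by have := part_index_itv hp x; lia.
have low_le x : V x -> low x <= f x.
  move=> Vx; have [Vz _ zmin] := firstP (p (part_index p x)).
  by apply: fnd; rewrite ?mem_set ?zmin //; have /andP[] := part_index_itv hp x.
exists (fun x => (low x).-1).
  by apply/unbounded_modP => m; apply: filterS (low_big m.+1) => x /=; lia.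
move=> g [W UW ginj] gh.
have UV' := ultraI UW (ultraI gh (low_big 0)).
set V' := _ `&` _ in UV'; apply: (not_count_after_le fqs UV').
apply: filterS2 UV UV' => x Vx V'x /=; apply: leq_trans (low_le x Vx).
apply: (@card_in_inj _ _ _ g) => [y z /set_mem[Wy _] /set_mem[Wz _]|y].
  by apply: ginj; exact: mem_set.
move=> [_ /= [gy y0]] yx.
suff -> : low x = low y by lia.
rewrite /low (@part_indexP _ (part_index p x) y) //.
by have := part_index_itv hp x; lia.
Qed.

Lemma increasing_above_before g : increasing_mod U g ->
  exists2 V, U V & U [set x | count_before p V x <= g x].
Proof.
move=> ginc; have [V UV ginj] := increasing_mod_injective ginc.
have {ginc} [V' UV' ginc] := ginc.
exists (V `&` V'); first exact: ultraI.
apply: filterS2 UV UV' => x Vx V'x /=.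
apply: (@card_in_inj _ _ _ g) => [y z /set_mem[Vy _] /set_mem[Vz _]|y].
  by apply: ginj; exact: mem_set.
by move=> [_ V'y] /andP[_ yx]; apply: ginc; rewrite ?mem_set.
Qed.

(** The first points of the blocks, which are discarded, are the places where
    the count may repeat its last value in the previous block. *)
Lemma nondecreasing_before V : U V ->
  nondecreasing_mod U (count_before p V) -> increasing_mod U (count_before p V).
Proof.
move=> UV [W0 UW0 and0].
pose W := V `&` W0; have UW : U W := ultraI UV UW0.
pose D := [set x | exists y, [/\ W y, y < x & part_index p y = part_index p x]].
have UD : U (W `&` D).
  have [UD|/ultra_not UnD] := pselect (U D); first exact: ultraI.
  exfalso; apply: (not_selection (ultraI UW UnD)) => x y [Wx _] [_ nDy] xy exy.
  by apply: nDy; exists x.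
have lt_block x y : V x -> x < y -> part_index p x = part_index p y ->
    count_before p V x < count_before p V y.
  move=> Vx xy exy; rewrite /count_before exy; apply: card_in_ltn => //.
  by rewrite -exy xy andbT; have /andP[] := part_index_itv hp x.
exists (W `&` D) => // x y /set_mem[[Vx W0x] _] /set_mem[Wy [z [[Vz W0z] zy ezy]]] xy.
have [exy|nexy] := eqVneq (part_index p x) (part_index p y); first exact: lt_block.
apply: leq_ltn_trans (lt_block _ _ Vz zy ezy).
apply: and0; rewrite ?mem_set // leqNgt; apply/negP => zx.
have := part_index_homo hp (ltnW zx); have := part_index_homo hp (ltnW xy).
by rewrite ezy; move/eqP: nexy; lia.
Qed.

(** The argument that max{A, B} = C.  The intervals [s x, t x) and [s' x, t' x)
    are the parts of the block of x before and after x, in either order. *)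
Lemma part_below_count (s t s' t' : nat -> nat) (hst : forall x, s x <= t x)
    (sum : forall V x,
      count_part p V x = card_in V (s x) (t x) + card_in V (s' x) (t' x))
    (unb : forall V, U V -> unbounded_mod U (fun x => card_in V (s x) (t x)))
    (dom : forall V, U V -> exists2 W, U W &
      U [set x | card_in W (s' x) (t' x) <= card_in V (s x) (t x)]) V :
  U V -> exists2 W, U W & U [set x | count_part p W x <= card_in V (s x) (t x)].
Proof.
move=> UV; have [V1 [UV1 _ c4]] := thinning UV.
have [V2 UV2 dom12] := dom _ UV1.
exists (V1 `&` V2); first exact: ultraI.
have /unbounded_modP/(_ 2) big := unb _ UV.
apply: filterS2 dom12 big => x /= dom12 big; rewrite sum.
have := card_in_sub (s x) (t x) (@subIsetl _ V1 V2).
have := card_in_sub (s' x) (t' x) (@subIsetr _ V1 V2).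
by have := c4 _ _ (hst x); lia.
Qed.

End Counts.

(** * Comparing cuts through their generators *)

Lemma cut_leP (c c' : cut (ultrapower U)) :
  reflect (cut_left c `<=` cut_left c') (c <= c')%O.
Proof. exact: asboolP. Qed.

Lemma cut_ltP (c c' : cut (ultrapower U)) :
  (c < c')%O <-> exists2 x, cut_left c' x & ~ cut_left c x.
Proof.
rewrite ltNge; split=> [/negP nle|[x c'x ncx]].
  have /existsNP[x /not_implyP[? ?]] : ~ (cut_left c' `<=` cut_left c).
    by move=> /cut_leP.
  by exists x.
by apply/negP => /cut_leP/(_ x c'x).
Qed.

Lemma down_closureP (F : set (nat -> nat)) f :
  down_closure (uclass U @` F) (uclass U f) <->
  exists2 g, F g & U [set x | f x <= g x].
Proof.
split=> [[_ [g Fg <-] /ultra_leP fg]|[g Fg fg]]; first by exists g.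
by exists (uclass U g); [exists g|apply/ultra_leP].
Qed.

Lemma up_closureP (F : set (nat -> nat)) f :
  up_closure (uclass U @` F) (uclass U f) <->
  exists2 g, F g & U [set x | g x <= f x].
Proof.
split=> [[_ [g Fg <-] /ultra_leP fg]|[g Fg fg]]; first by exists g.
by exists (uclass U g); [exists g|apply/ultra_leP].
Qed.

Lemma right_generated_leP (F G : set (nat -> nat)) :
  (right_generated (uclass U @` F) <= right_generated (uclass U @` G))%O <->
  forall g, G g -> exists2 f, F f & U [set x | f x <= g x].
Proof.
split=> [/cut_leP FG g Gg|FG].
  apply/up_closureP; apply: contrapT => nF; apply: (FG _ nF); apply/up_closureP.
  by exists g => //; exact: ultra_le_id.
apply/cut_leP => a; rewrite -[a]reprK => nF /up_closureP[g /FG[f Ff fg] ga].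
apply/nF/up_closureP; exists f => //.
by apply: filterS2 fg ga => x /=; exact: leq_trans.
Qed.

Lemma right_lt_leftP (F G : set (nat -> nat)) :
  (right_generated (uclass U @` F) < left_generated (uclass U @` G))%O <->
  exists g f, [/\ G g, F f & U [set x | f x <= g x]].
Proof.
split=> [/cut_ltP[a]|[g [f [Gg Ff fg]]]].
  rewrite -[a]reprK => /down_closureP[g Gg ag] /contrapT/up_closureP[f Ff fa].
  by exists g, f; split=> //; apply: filterS2 fa ag => x /=; exact: leq_trans.
apply/cut_ltP; exists (uclass U g).
  by apply/down_closureP; exists g => //; exact: ultra_le_id.
by move=> nF; apply: nF; apply/up_closureP; exists f.
Qed.

Lemma standard_bounded f : standard (uclass U f) -> ~ unbounded_mod U f.
Proof.
move=> [n _ /uclassP nf] /unbounded_modP/(_ n) fn.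
by have [x [/= ->]] := filter_ex (ultraI nf fn); rewrite ltnn.
Qed.

Lemma cutN_lt_left (F : set (nat -> nat)) f :
  F f -> unbounded_mod U f -> (cutN U < left_generated (uclass U @` F))%O.
Proof.
move=> Ff unb; apply/cut_ltP; exists (uclass U f).
  by apply/down_closureP; exists f => //; exact: ultra_le_id.
by move=> /standard_bounded.
Qed.

Lemma cutN_lt_right (F : set (nat -> nat)) h : unbounded_mod U h ->
  (forall f, F f -> ~ U [set x | f x <= h x]) ->
  (cutN U < right_generated (uclass U @` F))%O.
Proof.
move=> unb hF; apply/cut_ltP; exists (uclass U h).
  by move=> /up_closureP[f /hF].
by move=> /standard_bounded.
Qed.

End Modulo.

(** * The order of the cuts *)

Section Cuts.
Variables (U : np_ultrafilter) (p : nat -> nat).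
Hypotheses (hp : interval_partition p) (hsel : ~ has_selection_set U p).

Lemma cutA_le_cutE : (cutA U p <= cutE U)%O.
Proof.
apply/right_generated_leP => g /(increasing_above_before p)[V UV ag].
by exists (count_before p V) => //; exists V.
Qed.

Lemma cutS_le_cutE : (cutS U <= cutE U)%O.
Proof.
apply/right_generated_leP => g /increasing_mod_injective ginj.
by exists g => //; exact: ultra_le_id.
Qed.

Lemma cutF_le_cutB : (cutF U <= cutB U p)%O.
Proof.
rewrite leNgt; apply/negP => /right_lt_leftP[f [_ [fqs [V UV <-]]]].
exact: not_count_after_le.
Qed.

Lemma cutE_lt_cutF : strongly_quasi_selective U <-> (cutE U < cutF U)%O.
Proof.
rewrite strongly_quasi_selectiveP; split=> [efg|/right_lt_leftP//].
exact/right_lt_leftP.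
Qed.

Lemma cutA_le_cutC : (cutA U p <= cutC U p)%O.
Proof.
apply/right_generated_leP => _ [V UV <-]; exists (count_before p V); first by exists V.
by apply: filterS filterT => x _ /=; rewrite count_partE // leq_addr.
Qed.

Lemma cutB_le_cutC : (cutB U p <= cutC U p)%O.
Proof.
apply/right_generated_leP => _ [V UV <-]; exists (count_after p V); first by exists V.
by apply: filterS filterT => x _ /=; rewrite count_partE // leq_addl.
Qed.

Lemma max_cutA_cutB f : quasi_selective U f ->
  Order.max (cutA U p) (cutB U p) = cutC U p.
Proof.
move=> fqs.
have unb_after V : U V -> unbounded_mod U (count_after p V).
  move=> UV; apply: unbounded_mod_le fqs.1.
  by have [|/(not_count_after_le hp hsel fqs UV)] := ultra_leVge U f (count_after p V).
pose l x := p (part_index p x); pose r x := p (part_index p x).+1.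
have lxr x : l x <= x <= r x.
  by have /andP[lx /ltnW xr] := part_index_itv hp x; exact/andP.
apply/eqP; rewrite eq_le ge_max cutA_le_cutC cutB_le_cutC /= le_max.
apply/orP; have [/right_generated_leP dom|/ltW/right_generated_leP dom] :=
    leP (cutA U p) (cutB U p); [right|left].
  apply/right_generated_leP => _ [V UV <-].
  have [x||W UW|W UW|W UW cW] := @part_below_count U p id r l id _ _ _ _ V UV.
  - by have /andP[] := lxr x.
  - by move=> W x; rewrite count_partE // addnC.
  - exact: unb_after.
  - have [|_ [W' UW' <-] ?] := dom (count_after p W); first by exists W.
    by exists W'.
  by exists (count_part p W) => //; exists W.
have {}dom V : U V ->
    exists2 W, U W & U [set x | count_after p W x <= count_before p V x].
  move=> UV; have [|_ [W UW <-] ?] := dom (count_before p V); first by exists V.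
  by exists W.
apply/right_generated_leP => _ [V UV <-].
have [x||W UW||W UW cW] := @part_below_count U p l id id r _ _ _ _ V UV.
- by have /andP[] := lxr x.
- by move=> W x; rewrite count_partE.
- by have [W' /unb_after unbW' /unbounded_mod_le] := dom W UW; exact.
- exact: dom.
by exists (count_part p W) => //; exists W.
Qed.

Lemma cutE_le_cutS : strongly_quasi_selective U -> (cutE U <= cutS U)%O.
Proof.
move=> sqs; apply/right_generated_leP => g ginj.
apply: strongly_quasi_selective_above sqs _ => gnd; exists g.
  exact: nondecreasing_injective_mod.
exact: ultra_le_id.
Qed.

Lemma cutE_le_cutA : strongly_quasi_selective U -> (cutE U <= cutA U p)%O.
Proof.
move=> sqs; apply/right_generated_leP => _ [V UV <-].
apply: strongly_quasi_selective_above sqs _ => and0; exists (count_before p V).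
  exact: nondecreasing_before.
exact: ultra_le_id.
Qed.

End Cuts.

Theorem theorem1p6 (U : np_ultrafilter) (p : nat -> nat)
    (hU : properly_quasi_selective U)
    (hp : interval_partition p)
    (hsel : ~ has_selection_set U p) :
  [/\ cutN U < cutF U, cutN U < cutE U, cutN U < cutS U,
      cutN U < cutB U p & cutN U < cutC U p]%O /\
  [/\ cutA U p <= cutE U, cutS U <= cutE U, cutF U <= cutB U p
    & Order.max (cutA U p) (cutB U p) = cutC U p]%O /\
  (strongly_quasi_selective U <-> (cutE U < cutF U)%O) /\
  (strongly_quasi_selective U ->
    [/\ cutA U p = cutS U, cutS U = cutE U, cutE U < cutF U,
        cutF U <= cutB U p & cutB U p = cutC U p]%O).
Proof.
have [[f _ fqs] _] := hU.
have NF : (cutN U < cutF U)%O by apply: cutN_lt_left fqs.1.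
have [h unb hinj] := exists_below_injective hp hsel fqs.
have NS : (cutN U < cutS U)%O by apply: cutN_lt_right unb hinj.
have FB := cutF_le_cutB hp hsel; have SE := cutS_le_cutE U.
have BC := cutB_le_cutC U hp; have AE := cutA_le_cutE U p.
have maxC := max_cutA_cutB hp hsel fqs; have NB := lt_le_trans NF FB.
split; first by split=> //; [exact: lt_le_trans NS SE|exact: lt_le_trans NB BC].
do 2!split=> //; first exact: cutE_lt_cutF.
move=> sqs; have /cutE_lt_cutF EF := sqs.
have eSE : cutS U = cutE U by apply/le_anti; rewrite SE cutE_le_cutS.
have eAE : cutA U p = cutE U by apply/le_anti; rewrite AE cutE_le_cutA.
split=> //; first by rewrite eAE.
by rewrite -maxC max_r // eAE; apply: ltW; exact: lt_le_trans EF FB.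
Qed.
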